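(* Let $I$ be a proper, non-maximal, nonzero radical ideal of $S$, and set $R=k+I$. The following are equivalent: (i) $\dim S/I\ge 1$. (ii) $R$ is nonnoetherian. (iii) $R$ is depicted by $S$.
   Context: $k$ is an algebraically closed field, and $S$ is an integral domain and a finitely generated $k$-algebra. $k+I$ denotes the subalgebra $\{c+a: c\in k,\ a\in I\}$ of $S$; $\dim$ is Krull dimension. For a subalgebra $R\subseteq S$, $R$ is depicted by $S$ (or $S$ is a depiction of $R$) if the map $\operatorname{Spec}S\to\operatorname{Spec}R$, $\mathfrak q\mapsto\mathfrak q\cap R$, is surjective, and $$U_{S/R}:=\{\mathfrak n\in\operatorname{Max}S : R_{\mathfrak n\cap R}=S_{\mathfrak n}\}=\{\mathfrak n\in\operatorname{Max}S : R_{\mathfrak n\cap R}\text{ is noetherian}\}\neq\emptyset.$$ *)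

(* Defs.v *)
From HB Require Import structures.
From mathcomp Require Import all_boot all_algebra.
From mathcomp Require Import boolp classical_sets functions.
From mathcomp Require Import mpoly.

Set Implicit Arguments.
Unset Strict Implicit.
Unset Printing Implicit Defensive.

Import GRing.Theory.
Local Open Scope ring_scope.
Local Open Scope classical_set_scope.

(* Algebras over [k] that are integral domains. *)
#[short(type="idomainAlgType")]
HB.structure Definition IdomainAlgebra (k : nzRingType) :=
  {S of GRing.IntegralDomain S & GRing.ComUnitAlgebra k S}.

Definition finitely_generated_alg (k : comNzRingType) (S : comAlgType k) : Prop :=
  exists n (g : 'I_n -> S),
    forall x : S, exists p : {mpoly k[n]}, x = mmap (in_alg S) g p.

(* Subrings are represented by their carriers: below, [A] stands for a subring *)
(* of an ambient ring [T], and ideals of [A] are subsets of [T] contained in   *)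
(* [A]. The ring [T] itself is [[set: T]].                                     *)
Section Subrings.
Variable T : comNzRingType.
Implicit Types A J P M : set T.

Definition is_ideal A J : Prop :=
  [/\ J `<=` A, J 0,
      forall x y, J x -> J y -> J (x + y)
    & forall a x, A a -> J x -> J (a * x)].

Definition Spec A : set (set T) :=
  [set P | [/\ is_ideal A P, P <> A
    & forall a b, A a -> A b -> P (a * b) -> P a \/ P b]].

Definition Max A : set (set T) :=
  [set M | [/\ is_ideal A M, M <> A
    & forall J, is_ideal A J -> M `<=` J -> J = M \/ J = A]].

Definition noetherian A : Prop :=
  forall J, is_ideal A J -> exists n (g : 'I_n -> T),
    J = [set x | exists2 c : 'I_n -> T,
                   forall i, A (c i) & x = \sum_(i < n) c i * g i].

Definition prime_chain A (n : nat) (C : nat -> set T) : Prop :=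
  (forall i, (i <= n)%N -> Spec A (C i)) /\
  (forall i, (i < n)%N -> C i `<` C i.+1).

(* dim A >= n, where dim A is the supremum, possibly infinite, of the lengths *)
(* of the chains of primes of A.                                              *)
Definition krull_dim_ge A (n : nat) : Prop :=
  exists2 m, (n <= m)%N & exists C : nat -> set T, prime_chain A m C.

Definition radical_ideal A J : Prop :=
  is_ideal A J /\ forall x n, A x -> J (x ^+ n) -> J x.

End Subrings.

Section Depictions.
Variable S : idomainType.
Implicit Types R P : set S.

(* The localization R_P at a prime P of R, realized in the fraction field of S, *)
(* so that R_P and S_Q can be compared as sets.                                 *)
Definition localization R P : set {fraction S} :=
  [set z | exists a b, [/\ R a, R b, ~ P b & z = tofrac a / tofrac b]].

Definition U_locus R : set (set S) :=
  [set n | Max [set: S] n /\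
           localization R (n `&` R) = localization [set: S] n].

Definition noetherian_locus R : set (set S) :=
  [set n | Max [set: S] n /\ noetherian (localization R (n `&` R))].

Definition depicted R : Prop :=
  [/\ set_surj (Spec [set: S]) (Spec R) (fun q => q `&` R),
      U_locus R = noetherian_locus R & U_locus R !=set0].

End Depictions.

Definition scalars_plus (k : nzRingType) (S : lalgType k) (I : set S) : set S :=
  [set x | exists c a, I a /\ x = c%:A + a].

(* Main.v *)
Require Import Defs.
From HB Require Import structures.
From mathcomp Require Import all_boot all_algebra ring_quotient.
From mathcomp Require Import boolp classical_sets functions.
From mathcomp Require Import mpoly ring.

Set Implicit Arguments.
Unset Strict Implicit.
Unset Printing Implicit Defensive.

Import GRing.Theory.
Local Open Scope ring_scope.
Local Open Scope classical_set_scope.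

(** Write R = k + I. The pivot is the condition that S / I is finite
    dimensional over k: it is equivalent to R being noetherian, and also to the
    localization of R at its maximal ideal I being noetherian.

    If R, or only its localization at I, is noetherian, pick a nonzero a in I.
    Then aS (or its localization) is an ideal, so it is finitely generated;
    dividing by a shows that finitely many elements of S generate S over R
    up to denominators, which are nonzero scalars modulo I, hence span S / I
    (cofinite_of_local). Conversely, let S / I be finite dimensional and let J
    be an ideal of R. The largest ideal U of S inside J contains IJ, so
    JS / U is finite dimensional because JS is finitely generated over S, and so
    is its subspace J / U; and U is finitely generated over R because S is a
    finite R-module
    (noetherian_of_cofinite).

    Finite dimension of S / I is in turn equivalent to dim S / I = 0. If it is
    finite, every element of S is a scalar modulo each prime over I, as k is
    algebraically closed, so primes over I are maximal
    (cofinite_prime_residues). If it is infinite, an ideal maximal among those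
    over I of infinite codimension is prime (noncofinite_prime), and it is not
    maximal because maximal ideals have residue field k (nullstellensatz).

    For depictions, the contraction of primes from S to R is always surjective
    (spec_surj). At a maximal ideal n of S that does not contain I, the
    localizations of R and S agree (localization_away) and are noetherian; at
    one that contains I, the ring R is localized at I. So when S / I is
    infinite dimensional, both loci consist of the n that do not contain I, and
    the Nullstellensatz provides such an n because I is nonzero. When S / I is
    finite dimensional, the noetherian locus is everything, whereas the
    localizations of R and S differ over I: as I is radical but not maximal, at
    least two maximal ideals n1 and n2 contain it, and an element of n1 outside
    n2 is invertible in the localization of S at n2 but not in that of R at I.

    Ideals are finitely generated in the sense that a finite list lies in no
    smaller ideal (fin_gen), which avoids handling linear combinations. The
    Hilbert basis theorem and the Nullstellensatz, for the generators of S, are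
    both proved by adjoining one variable at a time. *)

(** * Ideals and noetherian subrings *)

Definition is_subring (T : comNzRingType) (A : set T) : Prop :=
  [/\ A 1, forall x y, A x -> A y -> A (x - y)
    & forall x y, A x -> A y -> A (x * y)].

Lemma is_subringT (T : comNzRingType) : is_subring [set: T].
Proof. by split. Qed.

Section Ideals.
Variables (T : comNzRingType) (A : set T).
Hypothesis subA : is_subring A.
Implicit Types J K : set T.

Let A1 : A 1. Proof. by case: subA. Qed.
Let AB x y : A x -> A y -> A (x - y). Proof. by case: subA => _ + _; apply. Qed.

Lemma subring0 : A 0.
Proof. by rewrite -(subrr 1); apply: AB. Qed.

Lemma subringN x : A x -> A (- x).
Proof. by rewrite -sub0r; apply: AB subring0. Qed.

Lemma subringD x y : A x -> A y -> A (x + y).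
Proof. by move=> Ax Ay; rewrite -[y]opprK; apply/AB/subringN. Qed.

Lemma subringM x y : A x -> A y -> A (x * y).
Proof. by case: subA => _ _; apply. Qed.

Lemma idealN J x : is_ideal A J -> J x -> J (- x).
Proof.
by case=> _ _ _ JM Jx; rewrite -mulN1r; apply: JM Jx; apply: subringN.
Qed.

Lemma idealB J x y : is_ideal A J -> J x -> J y -> J (x - y).
Proof.
by move=> idJ Jx Jy; case: (idJ) => _ _ JD _; apply: JD => //; apply: idealN.
Qed.

Lemma ideal_sum J n (F : 'I_n -> T) :
  is_ideal A J -> (forall i, J (F i)) -> J (\sum_(i < n) F i).
Proof.
by case=> _ J0 JD _ JF; elim/big_ind: _.
Qed.

Lemma ideal_proper J : is_ideal A J -> J <> A -> ~ J 1.
Proof.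
case=> JA _ _ JM JnA J1; apply: JnA; apply/seteqP; split=> // x Ax.
by rewrite -[x]mulr1; apply: JM.
Qed.

Lemma prime_ideal1 P : Spec A P -> ~ P 1.
Proof. by case=> idP PnA _; apply: ideal_proper. Qed.

(** Finite generation through the universal property of the generated ideal, so
    that proofs need no explicit linear combinations. *)
Definition fin_gen J : Prop :=
  exists2 s : seq T, (forall x, x \in s -> J x) &
    forall K, is_ideal A K -> (forall x, x \in s -> K x) -> J `<=` K.

Lemma noetherianP : noetherian A <-> (forall J, is_ideal A J -> fin_gen J).
Proof.
split=> nA J idJ.
  have [n [g ->]] := nA _ idJ.
  exists (codom g) => [x /codomP[i ->]|K idK gK _ [c Ac ->]].
    exists (fun j => (j == i)%:R) => [j|].
      by case: eqP => _ //; apply: subring0.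
    rewrite (bigD1 i) //= eqxx mul1r big1 ?addr0 // => j /negbTE->.
    by rewrite mul0r.
  apply: ideal_sum => // i; case: idK => _ _ _; apply=> //.
  by apply/gK/codom_f.
have [s sJ Js] := nA _ idJ; have [JA J0 JD JM] := idJ.
exists (size s), (tnth (in_tuple s)); apply/seteqP; split; last first.
  move=> _ [c Ac ->]; apply: ideal_sum => // i; apply: JM => //.
  by apply/sJ/mem_tnth.
apply: Js => [|x /(tnthP (in_tuple s))[i ->]]; last first.
  exists (fun j => (j == i)%:R) => [j|].
    by case: eqP => _ //; apply: subring0.
  rewrite (bigD1 i) //= eqxx mul1r big1 ?addr0 // => j /negbTE->.
  by rewrite mul0r.
split=> [_ [c Ac ->]| |_ _ [c Ac ->] [d Ad ->]|a _ Aa [c Ac ->]].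
- apply: JA; apply: ideal_sum => // i; apply: JM => //.
  by apply/sJ/mem_tnth.
- exists (fun=> 0) => [i|]; first exact: subring0.
  by rewrite big1 // => i _; rewrite mul0r.
- exists (fun i => c i + d i) => [i|]; first exact: subringD.
  by rewrite -big_split; apply: eq_bigr => i _; rewrite mulrDl.
- exists (fun i => a * c i) => [i|]; first exact: subringM.
  by rewrite mulr_sumr; apply: eq_bigr => i _; rewrite mulrA.
Qed.

(** The finitely many generators of the ideal generated by J only involve
    finitely many elements of J, and these already generate it. *)
Lemma noetherian_span J : noetherian A -> J `<=` A ->
  exists2 l : seq T, (forall x, x \in l -> J x) &
    forall K, is_ideal A K -> (forall x, x \in l -> K x) -> J `<=` K.
Proof.
move=> /noetherianP nA JA.
pose JA' := [set x | exists2 l : seq T, (forall y, y \in l -> J y) &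
  forall K, is_ideal A K -> (forall y, y \in l -> K y) -> K x].
have idA : is_ideal A A.
  split=> //; [exact: subring0 | exact: subringD | exact: subringM].
have idJA' : is_ideal A JA'.
  split.
  - by move=> x [l lJ lx]; apply: lx => // y /lJ/JA.
  - by exists [::] => // K [].
  - move=> x y [l lJ lx] [m mJ my]; exists (l ++ m) => [z|K idK lmK].
      by rewrite mem_cat => /orP[/lJ|/mJ].
    have [_ _ KD _] := idK; apply: KD; [apply: lx | apply: my] => // z zl;
      by apply: lmK; rewrite mem_cat zl ?orbT.
  - move=> a x Aa [l lJ lx]; exists l => // K idK lK.
    by case: (idK) => _ _ _; apply=> //; apply: lx.
have [s sJ Js] := nA _ idJA'.
have [l lJ ls] : exists2 l : seq T, (forall y, y \in l -> J y) &
    forall K, is_ideal A K -> (forall y, y \in l -> K y) ->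
    forall x, x \in s -> K x.
  elim: s sJ {Js} => [|x s IHs] sJ; first by exists [::].
  have [|l lJ ls] := IHs; first by move=> y ys; apply: sJ; rewrite inE ys orbT.
  have [m mJ mx] := sJ x (mem_head _ _).
  exists (l ++ m) => [z|K idK lmK z /[!inE] /predU1P[->|zs]].
  - by rewrite mem_cat => /orP[/lJ|/mJ].
  - by apply: mx => // y ym; apply: lmK; rewrite mem_cat ym orbT.
  - by apply: ls zs => // y yl; apply: lmK; rewrite mem_cat yl.
exists l => // K idK lK x Jx; apply: (Js K idK); first exact: ls.
by exists [:: x] => [y /[!inE] /eqP->//|L _]; apply; apply: mem_head.
Qed.

Lemma chain_sub_seq (F : set (set T)) (X0 : set T) (s : seq T) :
  total_on F subset -> F X0 ->
  (forall x, x \in s -> (\bigcup_(X in F) X) x) ->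
  exists2 X, F X & forall x, x \in s -> X x.
Proof.
move=> totF FX0; elim: s => [|y s IHs] sF; first by exists X0.
have [|X FX sX] := IHs; first by move=> x xs; apply: sF; rewrite inE xs orbT.
have [Y FY Yy] := sF y (mem_head _ _).
have [XY|YX] := totF _ _ FX FY.
  by exists Y => // x /[!inE] /predU1P[->|/sX/XY].
by exists X => // x /[!inE] /predU1P[->|/sX//]; apply: YX.
Qed.

(** By Zorn's lemma: the union of a nonempty chain in F is an ideal, a finite
    set of generators lies in one member of the chain, and that member is then
    the union. *)
Lemma noetherian_max (F : set (set T)) J0 :
  noetherian A -> (forall J, F J -> is_ideal A J) -> F J0 ->
  exists M, [/\ F M, J0 `<=` M & forall K, F K -> M `<=` K -> K `<=` M].
Proof.
move=> /noetherianP nA Fid FJ0.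
(* The empty set is added because it is the union of the empty chain. *)
pose P X := X = set0 \/ (F X /\ J0 `<=` X).
have [|M [PM maxM]] := @Zorn_bigcup T P.
  move=> G GP totG.
  have [[X0 GX0 X0n0]|allG0] :=
      pselect (exists2 X, G X & X <> set0); last first.
    left; apply/seteqP; split=> // x [X GX Xx].
    have [XE|] := pselect (X = set0); first by rewrite XE in Xx.
    by move=> Xn0; case: allG0; exists X.
  pose G' := [set X | G X /\ X <> set0].
  have totG' : total_on G' subset by move=> X Y [GX _] [GY _]; apply: totG.
  have UE : \bigcup_(X in G) X = \bigcup_(X in G') X.
    apply/seteqP; split=> x [X]; last by case=> GX _ Xx; exists X.
    by move=> GX Xx; exists X => //; split=> // XE; rewrite XE in Xx.
  have G'F X : G' X -> F X /\ J0 `<=` X by case=> /GP[].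
  have G'X0 : G' X0 by [].
  have idU : is_ideal A (\bigcup_(X in G') X).
    split.
    - by move=> x [X /G'F[/Fid[XA _ _ _] _] /XA].
    - by exists X0 => //; have [/Fid[]] := G'F _ G'X0.
    - move=> x y Ux Uy.
      have [|X G'X sX] := @chain_sub_seq G' X0 [:: x; y] totG' G'X0.
        by move=> z /[!inE] /orP[]/eqP->.
      exists X => //; have [/Fid[_ _ XD _] _] := G'F _ G'X.
      by apply: XD; apply: sX; rewrite !inE eqxx ?orbT.
    - move=> a x Aa [X G'X Xx]; exists X => //.
      by have [/Fid[_ _ _ XM] _] := G'F _ G'X; apply: XM.
  have [s sU Us] := nA _ idU.
  have [X G'X sX] := chain_sub_seq totG' G'X0 sU.
  have [FX J0X] := G'F _ G'X.
  have UX : \bigcup_(X in G') X = X.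
    by apply/seteqP; split; [apply: Us => //; apply: Fid | move=> x; exists X].
  by right; rewrite UE UX.
case: PM => [M0|[FM J0M]].
  case: (maxM J0); last by right; split.
  have [_ J00 _ _] := Fid _ FJ0.
  by rewrite M0; split=> // J0s; apply: J0s J00.
exists M; split=> // K FK MK x Kx; apply: contrapT => nMx.
apply: (maxM K); last by right; split=> //; apply: subset_trans MK.
by split=> // KM; apply/nMx/KM.
Qed.

(** The ideal J + Ac. *)
Definition ideal_adjoin J c : set T :=
  [set x | exists p r, [/\ J p, A r & x = p + r * c]].

Lemma ideal_adjoin_is_ideal J c :
  is_ideal A J -> A c -> is_ideal A (ideal_adjoin J c).
Proof.
move=> [JA J0 JD JM] Ac; split.
- by move=> _ [p [r [/JA Ap Ar ->]]]; apply/subringD/subringM.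
- by exists 0, 0; rewrite mul0r addr0; split=> //; apply: subring0.
- move=> _ _ [p [r [Pp Ar ->]]] [p' [r' [Pp' Ar' ->]]].
  exists (p + p'), (r + r'); rewrite mulrDl addrACA.
  by split=> //; [apply: JD | apply: subringD].
- move=> u _ Au [p [r [Pp Ar ->]]]; exists (u * p), (u * r).
  by rewrite mulrDr mulrA; split=> //; [apply: JM | apply: subringM].
Qed.

Lemma sub_ideal_adjoin J c : J `<=` ideal_adjoin J c.
Proof.
by move=> p Jp; exists p, 0; rewrite mul0r addr0; split=> //; apply: subring0.
Qed.

Lemma mem_ideal_adjoin J c : is_ideal A J -> ideal_adjoin J c c.
Proof. by case=> _ J0 _ _; exists 0, 1; rewrite mul1r add0r. Qed.

(** An ideal maximal among those disjoint from M is prime: if it contained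
    neither a nor b, adjoining either would give an element of M, and the
    product of these two elements of M would lie in it once ab does. *)
Lemma prime_avoiding (J : set T) (M : set T) :
  noetherian A -> is_ideal A J -> M 1 ->
  (forall x y, M x -> M y -> M (x * y)) -> (forall x, M x -> ~ J x) ->
  exists P, [/\ Spec A P, J `<=` P & forall x, M x -> ~ P x].
Proof.
move=> nA idJ M1 MM MJ.
pose F K := is_ideal A K /\ forall x, M x -> ~ K x.
have [|//|P [[idP MP] JP maxP]] := @noetherian_max F J nA; first by move=> K [].
exists P; split=> //; split=> //.
  by move=> PA; apply: (MP 1) => //; rewrite PA.
move=> a b Aa Ab Pab; have [PA P0 PD PM] := idP.
have meet c : A c -> ~ P c -> exists2 x, M x & ideal_adjoin P c x.
  move=> Ac nPc; apply: contrapT => nMQ; apply: nPc.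
  apply: (maxP (ideal_adjoin P c)); last exact: mem_ideal_adjoin.
    split; first exact: ideal_adjoin_is_ideal.
    by move=> x Mx Qx; apply: nMQ; exists x.
  exact: sub_ideal_adjoin.
have [Pa|/(meet _ Aa)[x Mx [p [r [Pp Ar xE]]]]] := pselect (P a); first by left.
have [Pb|/(meet _ Ab)[y My [q [t [Pq At yE]]]]] := pselect (P b).
  by right.
case: (MP (x * y)); first exact: MM.
have -> : x * y = (q + t * b) * p + (r * a) * q + (r * t) * (a * b).
  by rewrite xE yE; ring.
have APb : A (q + t * b) by apply/subringD/subringM => //; apply: PA.
have h1 := PM _ _ APb Pp; have h2 := PM _ _ (subringM Ar Aa) Pq.
exact: PD (PD _ _ h1 h2) (PM _ _ (subringM Ar At) Pab).
Qed.

End Ideals.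

Lemma max_prime (T : comNzRingType) (A M : set T) :
  is_subring A -> Max A M -> Spec A M.
Proof.
move=> subA [idM MnA maxM]; split=> // a b Aa Ab Mab.
have [Ma|nMa] := pselect (M a); [by left | right].
have [E|E] :=
    maxM _ (ideal_adjoin_is_ideal subA idM Aa) (sub_ideal_adjoin subA a).
  by case: nMa; rewrite -E; apply: mem_ideal_adjoin.
have [A1 _ _] := subA; have [MA _ MD MM] := idM.
have : ideal_adjoin A M a 1 by rewrite E.
case=> p [r [Mp Ar E1]]; rewrite -[b]mul1r E1 mulrDl mulrC -mulrA.
by apply: MD; apply: MM.
Qed.

Lemma spec_contract (T : comNzRingType) (A P : set T) :
  is_subring A -> Spec [set: T] P -> Spec A (P `&` A).
Proof.
move=> subA primeP; have [idP _ PM] := primeP; have [A1 _ _] := subA.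
have [_ P0 PD PMl] := idP; split.
- split=> [x []//||x y [Px Ax] [Py Ay]|a x Aa [Px Ax]].
  + by split=> //; apply: subring0.
  + by split; [apply: PD | apply: subringD].
  + by split; [apply: PMl | apply: subringM].
- by move=> E; apply: (prime_ideal1 primeP); move: A1; rewrite -E => -[].
- by move=> a b Aa Ab [/(PM _ _ I I)[] ? _]; [left | right].
Qed.

(** To test generation it suffices to consider ideals inside J. *)
Lemma fin_gen_sub (T : comNzRingType) (A J : set T) (s : seq T) :
  is_ideal A J -> (forall x, x \in s -> J x) ->
  (forall K, is_ideal A K -> K `<=` J ->
     (forall x, x \in s -> K x) -> J `<=` K) ->
  fin_gen A J.
Proof.
move=> idJ sJ Js; exists s => // K idK sK.
have [JA J0 JD JM] := idJ; have [KA K0 KD KM] := idK.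
apply: subset_trans (@subIsetr _ J K); apply: Js => [||x xs]; last 2 first.
- exact: subIsetl.
- by split; [apply: sJ | apply: sK].
split=> [x [/JA]//||x y [Jx Kx] [Jy Ky]|a x Aa [Jx Kx]]; split; auto.
Qed.

Section Image.
Variables (A B : comNzRingType) (h : {rmorphism A -> B}).

Lemma ideal_preim (J : set B) :
  is_ideal [set: B] J -> is_ideal [set: A] (h @^-1` J).
Proof.
case=> _ J0 JD JM; split=> //=; first by rewrite rmorph0.
  by move=> x y Jx Jy; rewrite rmorphD; apply: JD.
by move=> a x _ Jx; rewrite rmorphM; apply: JM.
Qed.

Lemma prime_preim (P : set B) : Spec [set: B] P -> Spec [set: A] (h @^-1` P).
Proof.
move=> primeP; have [idP PnB PM] := primeP; split; first exact: ideal_preim.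
  move=> hPA; apply: (prime_ideal1 primeP).
  by rewrite -(rmorph1 h); have : [set: A] 1 by []; rewrite -hPA.
by move=> a b _ _ /=; rewrite rmorphM; apply: PM.
Qed.

Lemma prime_image (P : set A) :
  (forall y, exists x, h x = y) -> (forall x, h x = 0 -> P x) ->
  Spec [set: A] P -> Spec [set: B] (h @` P).
Proof.
move=> h_surj kerP primeP; have [idP _ PM] := primeP; have [_ P0 PD PMl] := idP.
have inP x : (h @` P) (h x) -> P x.
  case=> y Py yx; rewrite -[x](subrK y); apply: PD => //.
  by apply: kerP; rewrite rmorphB yx subrr.
split.
- split=> //; first by exists 0; rewrite ?rmorph0.
    move=> _ _ [x Px <-] [y Py <-].
    by exists (x + y); rewrite ?rmorphD //; apply: PD.
  move=> b _ _ [x Px <-]; have [a <-] := h_surj b.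
  by exists (a * x); rewrite ?rmorphM //; apply: PMl.
- move=> E; apply: (prime_ideal1 primeP); apply: inP; rewrite E //.
- move=> a b _ _; have [x <-] := h_surj a; have [y <-] := h_surj b.
  rewrite -rmorphM => /inP /(PM _ _ I I)[Px|Py].
    by left; exists x.
  by right; exists y.
Qed.

Lemma noetherian_surj : (forall y, exists x, h x = y) ->
  noetherian [set: A] -> noetherian [set: B].
Proof.
move=> h_surj /(noetherianP (is_subringT _)) nA.
apply/(noetherianP (is_subringT _)) => J idJ.
have [s sJ Js] := nA _ (ideal_preim idJ).
exists (map h s) => [_ /mapP[x /sJ Jx ->] //|K idK sK y Jy].
have [x xy] := h_surj y; rewrite -xy.
apply: (Js _ (ideal_preim idK)) => [z zs|]; last by rewrite /= xy.
by apply: sK; apply: map_f.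
Qed.

End Image.

(** * The Hilbert basis theorem *)

Section HilbertBasis.
Variable A : comNzRingType.
Implicit Types (J K : set {poly A}) (f : {poly A}).

(** Together with 0, the leading coefficients of the elements of J of degree
    j. *)
Definition coef_ideal J (j : nat) : set A :=
  [set c | exists2 f, J f /\ (size f <= j.+1)%N & f`_j = c].

Lemma coef_ideal_is_ideal J j :
  is_ideal [set: _] J -> is_ideal [set: A] (coef_ideal J j).
Proof.
case=> _ J0 JD JM; split=> //.
- by exists 0; rewrite ?coef0 //; split=> //=; rewrite size_poly0.
- move=> _ _ [f [Jf sf] <-] [g [Jg sg] <-].
  exists (f + g); last by rewrite coefD.
  split; first exact: JD.
  by rewrite /= (leq_trans (size_polyD _ _)) // geq_max sf.
- move=> a _ _ [f [Jf sf] <-]; exists (a%:P * f); last by rewrite coefCM.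
  split; first exact: JM.
  by rewrite /= mul_polyC (leq_trans (size_scale_leq _ _)).
Qed.

Lemma coef_idealS J i j :
  is_ideal [set: _] J -> (i <= j)%N -> coef_ideal J i `<=` coef_ideal J j.
Proof.
case=> _ J0 JD JM /subnK<- _ [f [Jf sf] <-]; exists ('X^(j - i) * f).
  split; first exact: JM.
  apply/leq_sizeP => l; rewrite -addnS => le_l; rewrite coefXnM.
  rewrite ltnNge (leq_trans (leq_addr _ _) le_l) /=.
  move/leq_sizeP: sf; apply.
  by rewrite leq_subRL // (leq_trans _ le_l) ?leq_addr.
by rewrite coefXnM ltnNge leq_addr /= addnC addnK.
Qed.

(** Cancel leading terms: an element of J has the same leading coefficient as
    some element of K of no larger degree, and their difference has smaller
    size. *)
Lemma coef_ideal_inj J K :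
  is_ideal [set: _] J -> is_ideal [set: _] K -> K `<=` J ->
  (forall j, coef_ideal J j `<=` coef_ideal K j) -> J `<=` K.
Proof.
move=> idJ idK KJ sJK f; have [_ K0 KD _] := idK.
elim: {f}_.+1 {-2}f (ltnSn (size f)) => // n IHn f.
rewrite ltnS leq_eqVlt => /predU1P[szf|/IHn//] Jf.
case: n szf IHn => [/eqP|n szf IHn].
  by rewrite size_poly_eq0 => /eqP->.
have [g [Kg sg] gn] : coef_ideal K n f`_n.
  by apply: sJK; exists f => //; split=> //=; rewrite szf.
rewrite -[f](subrK g); apply: KD => //; apply: IHn; last first.
  by apply: (idealB (is_subringT _)) => //; apply: KJ.
rewrite ltnS; apply/leq_sizeP => i; rewrite leq_eqVlt => /predU1P[<-|lt_ni].
  by rewrite coefB gn subrr.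
by rewrite coefB !nth_default ?subrr ?szf //; apply: leq_trans sg lt_ni.
Qed.

Lemma coef_ideal_lift J j (s : seq A) :
  (forall x, x \in s -> coef_ideal J j x) ->
  exists2 l : seq {poly A}, (forall f, f \in l -> J f) &
    forall K, (forall f, f \in l -> K f) ->
    forall x, x \in s -> coef_ideal K j x.
Proof.
elim: s => [|y s IHs] sJ; first by exists [::].
have [|l lJ lK] := IHs; first by move=> x xs; apply: sJ; rewrite inE xs orbT.
have [f [Jf sf] fy] := sJ y (mem_head _ _).
exists (f :: l) => [g|K flK x]; first by rewrite inE => /predU1P[->|/lJ].
rewrite inE => /predU1P[->|xs].
  by exists f => //; split=> //; apply/flK/mem_head.
by apply: lK => // g gl; apply: flK; rewrite inE gl orbT.
Qed.

(** The ideals of leading coefficients increase with the degree, so they are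
    constant from some degree N on. Lifts of generators of the first N + 1 of
    them generate J by coef_ideal_inj. *)
Lemma hilbert_basis : noetherian [set: A] -> noetherian [set: {poly A}].
Proof.
move=> /(noetherianP (is_subringT _)) nA.
apply/(noetherianP (is_subringT _)) => J idJ.
have idL j := coef_ideal_is_ideal j idJ.
have [N LN] : exists N, forall j, coef_ideal J j `<=` coef_ideal J N.
  pose U := \bigcup_j coef_ideal J j.
  have [|s sU Us] := nA U.
    split=> //; first by exists 0%N => //; case: (idL 0%N).
      move=> x y [i _ Lx] [j _ Ly]; exists (maxn i j) => //.
      have [_ _ LD _] := idL (maxn i j).
      by apply: LD; [move: Lx | move: Ly]; apply: coef_idealS;
        rewrite ?leq_maxl ?leq_maxr.
    move=> a x _ [i _ Lx]; exists i => //.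
    by have [_ _ _ LM] := idL i; apply: LM.
  have [N sN] : exists N, forall x, x \in s -> coef_ideal J N x.
    elim: s {Us} sU => [|y s IHs] sU; first by exists 0%N.
    have [|N sN] := IHs; first by move=> x xs; apply: sU; rewrite inE xs orbT.
    have [i _ Ly] := sU y (mem_head _ _).
    exists (maxn i N) => x /[!inE] /predU1P[->|/sN Lx].
      by apply: coef_idealS Ly; rewrite ?leq_maxl.
    by apply: coef_idealS Lx; rewrite ?leq_maxr.
  exists N => j x Lx; apply: (Us _ (idL N) sN).
  by exists j.
have [l lJ lK] : exists2 l : seq {poly A}, (forall f, f \in l -> J f) &
    forall K, is_ideal [set: _] K -> (forall f, f \in l -> K f) ->
    forall j, (j <= N)%N -> coef_ideal J j `<=` coef_ideal K j.
  elim: N {LN} => [|N [l lJ lK]].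
    have [s sJ Js] := nA _ (idL 0%N); have [l lJ lK] := coef_ideal_lift sJ.
    exists l => // K idK /lK sK j /[!leqn0] /eqP->.
    by apply: Js => //; apply: coef_ideal_is_ideal.
  have [s sJ Js] := nA _ (idL N.+1); have [l' l'J l'K] := coef_ideal_lift sJ.
  exists (l ++ l') => [f|K idK llK j].
    by rewrite mem_cat => /orP[/lJ|/l'J].
  rewrite leq_eqVlt => /predU1P[->|].
    apply: Js; first exact: coef_ideal_is_ideal.
    by apply: l'K => f fl; apply: llK; rewrite mem_cat fl orbT.
  by apply: lK => // f fl; apply: llK; rewrite mem_cat fl.
apply: (fin_gen_sub idJ lJ) => K idK KJ /(lK _ idK) JK.
apply: coef_ideal_inj => // j; have [/JK//|/ltnW leNj] := leqP j N.
apply: subset_trans (LN j) _.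
by apply: subset_trans (JK _ (leqnn _)) (coef_idealS _ _).
Qed.

End HilbertBasis.

Lemma noetherian_field (F : fieldType) : noetherian [set: F].
Proof.
apply/(noetherianP (is_subringT _)) => J [_ J0 _ JM].
have [[x Jx x0]|J0'] := pselect (exists2 x, J x & x != 0).
  exists [:: x] => [y /[!inE] /eqP->//|K [_ _ _ KM] xK y _].
  by rewrite -(divfK x0 y); apply: KM => //; apply/xK/mem_head.
exists [::] => // K [_ K0 _ _] _ y Jy.
by have [->//|y0] := eqVneq y 0; case: J0'; exists y.
Qed.

Section MpolyAsPoly.
Variables (R : comNzRingType) (n : nat).

(** The inverse of muni, as a ring morphism. *)
Definition poly_mpoly : {rmorphism {poly {mpoly R[n]}} -> {mpoly R[n.+1]}} :=
  horner_eval 'X_ord_max \o map_poly (@mwiden n R).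

Lemma muniK : cancel (@muni n R) poly_mpoly.
Proof.
move=> p; rewrite muniE rmorph_sum /= [RHS]mpolyE; apply: eq_bigr => m _.
rewrite /poly_mpoly /= /horner_eval !map_polyZ map_polyXn.
rewrite !hornerZ hornerXn.
rewrite /= mwidenZ mwidenX.
rewrite -scalerAl; congr (_ *: _).
rewrite [RHS]mpolyXE_id [in LHS]mpolyXE_id !big_ord_recr /=.
rewrite mnmwiden_ordmax expr0 mulr1; congr (_ * _).
by apply: eq_bigr => i _; rewrite mnmwiden_widen mnmE.
Qed.

End MpolyAsPoly.

Lemma noetherian_mpoly (R : comNzRingType) n :
  noetherian [set: R] -> noetherian [set: {mpoly R[n]}].
Proof.
move=> nR; elim: n => [|n IHn].
  refine (noetherian_surj (h := @mpolyC 0 R) _ nR) => p.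
  exists p@_0; apply/mpolyP => m; rewrite mcoeffC.
  by rewrite (_ : m = 0%MM) ?eqxx ?mulr1 //; apply/mnmP => -[].
refine (noetherian_surj (h := @poly_mpoly R n) _ (hilbert_basis (@IHn))) => p.
by exists (muni p); exact (muniK p).
Qed.

(** * Localization *)

Section Localization.
Variable S : idomainType.
Variables (R P : set S).
Hypotheses (subR : is_subring R) (primeP : Spec R P).

Lemma is_subring_localization : is_subring (localization R P).
Proof.
have [R1 _ RM] := subR; have [idP PnR PM] := primeP.
have n0 b : ~ P b -> tofrac b != 0.
  rewrite tofrac_eq0 => nPb; apply/eqP => b0; apply: nPb; rewrite b0.
  by case: idP.
split.
- exists 1, 1; split=> //; first exact: prime_ideal1 primeP.
  by rewrite tofrac1 divr1.
- move=> _ _ [a [b [Ra Rb nPb ->]]] [c [d [Rc Rd nPd ->]]].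
  exists (a * d - c * b), (b * d); split; auto.
    by case: subR => _ RB _; apply: RB; apply: RM.
    by move/(PM _ _ Rb Rd) => [].
  by rewrite tofracB !tofracM -mulNr addf_div ?n0 // mulNr.
- move=> _ _ [a [b [Ra Rb nPb ->]]] [c [d [Rc Rd nPd ->]]].
  exists (a * c), (b * d); split; auto.
    by move/(PM _ _ Rb Rd) => [].
  by rewrite !tofracM mulf_div.
Qed.

Lemma localization_tofrac x : R x -> localization R P (tofrac x).
Proof.
have [R1 _ _] := subR => Rx; exists x, 1; split=> //.
  exact: prime_ideal1 primeP.
by rewrite tofrac1 divr1.
Qed.

(** An ideal of the localization is generated by its elements that lie in R. *)
Lemma noetherian_localization : noetherian R -> noetherian (localization R P).
Proof.
have [R1 _ RM] := subR; have [idP PnR PM] := primeP.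
have n0 b : ~ P b -> tofrac b != 0.
  rewrite tofrac_eq0 => nPb; apply/eqP => b0; apply: nPb; rewrite b0.
  by case: idP.
move=> /(noetherianP subR) nR.
apply/(noetherianP is_subring_localization) => J idJ.
pose contr K := [set x | R x /\ K (tofrac x)].
have idc K : is_ideal (localization R P) K -> is_ideal R (contr K).
  case=> _ K0 KD KM; split.
  - by move=> x [].
  - by split; [exact: subring0 | rewrite tofrac0].
  - move=> x y [Rx Kx] [Ry Ky]; split; first exact: subringD.
    by rewrite tofracD; apply: KD.
  - move=> a x Ra [Rx Kx]; split; first exact: RM.
    by rewrite tofracM; apply: KM => //; apply: localization_tofrac.
have [s sJ Js] := nR _ (idc _ idJ).
exists (map (@tofrac S) s) => [_ /mapP[x /sJ[_ Jx] ->] //|K idK sK z Jz].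
have [JR _ _ JM] := idJ; have [a [b [Ra Rb nPb zE]]] := JR _ Jz.
have [_ Ka] : contr K a.
  apply: (Js _ (idc _ idK)) => [x xs|].
    by have [Rx _] := sJ _ xs; split=> //; apply/sK/map_f.
  split=> //; have -> : tofrac a = tofrac b * z by rewrite zE mulrC divfK ?n0.
  by apply: JM => //; apply: localization_tofrac.
have -> : z = (tofrac 1 / tofrac b) * tofrac a.
  by rewrite zE tofrac1 mul1r mulrC.
by case: idK => _ _ _ KM; apply: KM => //; exists 1, b.
Qed.

End Localization.

(** * The Nullstellensatz *)

(** The form of the Nullstellensatz that survives adjoining a variable: k-points
    of the closed set of a prime P are dense in it. *)
Definition scalar_points (k : fieldType) (A : comNzRingType)
    (c : {rmorphism k -> A}) : Prop :=
  forall (P : set A) (b : A), Spec [set: A] P -> ~ P b ->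
  exists phi : {rmorphism A -> k},
    [/\ cancel c phi, forall x, P x -> phi x = 0 & phi b != 0].

Section Extension.
Variables (A : idomainType) (P : set {poly A}).
Hypothesis primeP : Spec [set: {poly A}] P.
Implicit Types (f g h : {poly A}) (Q : set {poly A}).

Definition eval_at (k : comNzRingType) (phi : {rmorphism A -> k}) (y : k) :
  {rmorphism {poly A} -> k} := horner_eval y \o map_poly phi.

Lemma eval_atE (k : comNzRingType) (phi : {rmorphism A -> k}) y f :
  eval_at phi y f = (map_poly phi f).[y].
Proof. by []. Qed.

Let idP : is_ideal [set: {poly A}] P. Proof. by case: primeP. Qed.
Let PM f g : P (f * g) -> P f \/ P g.
Proof. by case: primeP => _ _; apply. Qed.
Let P0 : P 0. Proof. by case: idP. Qed.
Let PMl f g : P g -> P (f * g). Proof. by case: idP => _ _ _; apply. Qed.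
Let PD f g : P f -> P g -> P (f + g).
Proof. by case: idP => _ _ + _; apply. Qed.

(** The polynomials whose image over the quotient of A by the contraction of P
    is zero. *)
Definition coefs_in f := forall i, P (f`_i)%:P.

Let coefs_in_P f : coefs_in f -> P f.
Proof.
move=> fP; rewrite -[f]coefK poly_def.
apply: (ideal_sum idP) => i; rewrite -mul_polyC mulrC; exact: PMl.
Qed.

Let coefs_inM f g : coefs_in g -> coefs_in (f * g).
Proof.
move=> gP i; rewrite coefM rmorph_sum; apply: (ideal_sum idP) => j.
by rewrite rmorphM; apply/PMl/gP.
Qed.

Let coefs_inD f g : coefs_in f -> coefs_in g -> coefs_in (f + g).
Proof.
by move=> fP gP i; rewrite coefD rmorphD; apply: PD; [apply: fP | apply: gP].
Qed.

Let lead_pow f n : ~ P (lead_coef f)%:P -> ~ P (lead_coef f ^+ n)%:P.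
Proof.
move=> nP; elim: n => [|n IHn]; first exact: prime_ideal1 primeP.
by rewrite exprS rmorphM => /PM[].
Qed.

(** Choose h of minimal degree among the elements of Q with a coefficient
    outside P: if its leading coefficient were in P, removing the leading term
    would give such an element of smaller degree. *)
Lemma minimal_lead Q f : is_ideal [set: _] Q -> P `<=` Q -> Q f ->
  ~ coefs_in f ->
  exists h, [/\ Q h, ~ P (lead_coef h)%:P &
    forall g, Q g -> (size g < size h)%N -> coefs_in g].
Proof.
move=> idQ PQ; elim: {f}_.+1 {-2}f (ltnSn (size f)) => // n IHn f.
rewrite ltnS => szf Qf nf.
have [[g [Qg ng szg]]|min] :=
    pselect (exists g, [/\ Q g, ~ coefs_in g & (size g < size f)%N]).
  exact: IHn (leq_trans szg szf) Qg ng.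
have small g : Q g -> (size g < size f)%N -> coefs_in g.
  by move=> Qg szg; apply: contrapT => ng; apply: min; exists g.
exists f; split=> // Plf; apply: nf.
pose m := (lead_coef f)%:P * 'X^((size f).-1).
have mP : coefs_in m.
  move=> i; rewrite coefCM coefXn rmorphM mulrC; exact: PMl.
have [->|f0] := eqVneq f 0; first by move=> i; rewrite coef0.
rewrite -[f](subrK m); apply: coefs_inD => //; apply: small.
  by apply: (idealB (is_subringT _)) => //; apply/PQ/coefs_in_P.
rewrite -[X in (_ < X)%N]prednK ?size_poly_gt0 // ltnS.
apply/leq_sizeP => i; rewrite coefB coefCM coefXn leq_eqVlt.
case/predU1P=> [<-|lt_i]; first by rewrite eqxx mulr1 subrr.
rewrite gtn_eqF // mulr0 subr0 nth_default //.
by rewrite -[size f]prednK ?size_poly_gt0.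
Qed.

Import Pdiv.Idomain.

Lemma pdiv_small Q h g : is_ideal [set: _] Q -> P `<=` Q ->
  (forall g, Q g -> (size g < size h)%N -> coefs_in g) ->
  h != 0 -> Q h -> Q g -> coefs_in (g %% h).
Proof.
move=> idQ PQ small h0 Qh Qg; apply: small; last by rewrite ltn_modpN0.
have -> : g %% h = lead_coef h ^+ scalp g h *: g - (g %/ h) * h.
  by rewrite divp_eq addrC addKr.
have [_ _ _ QM] := idQ.
by apply: (idealB (is_subringT _)) => //; rewrite -?mul_polyC; apply: QM.
Qed.

(** Let p be the contraction of P to A. If P is the extension of p, a
    coefficient of b outside p can serve as a, since a nonzero polynomial over
    the infinite field k has a nonroot. Otherwise the variable is algebraic
    modulo P over A / p. Then b divides modulo P some element u of A outside p,
    and f in P of minimal degree among those not in the extension of p is, up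
    to powers of its leading coefficient l, a generator of P modulo that
    extension. So a = l u works: any root of the image of f defines a point
    that kills P, and b does not vanish there because u does not. *)
Lemma point_extension b : ~ P b ->
  exists2 a, ~ P a%:P & forall (k : closedFieldType) (phi : {rmorphism A -> k}),
    (forall x, P x%:P -> phi x = 0) -> phi a != 0 ->
    exists y, (forall f, P f -> eval_at phi y f = 0) /\ eval_at phi y b != 0.
Proof.
move=> nPb.
have kill (k : closedFieldType) (phi : {rmorphism A -> k}) y f :
    (forall x, P x%:P -> phi x = 0) -> coefs_in f -> eval_at phi y f = 0.
  move=> phiP fP; rewrite eval_atE (_ : map_poly phi f = 0) ?horner0 //.
  by apply/polyP => i; rewrite coef_map coef0; apply: phiP.
have [[f0 Pf0 nf0]|allP] := pselect (exists2 f, P f & ~ coefs_in f); last first.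
  have [i nPi] : exists i, ~ P (b`_i)%:P.
    by apply: contrapT => nb; apply/nPb/coefs_in_P => i; apply: contrapT => nPi;
      apply: nb; exists i.
  exists b`_i => // k phi phiP phib.
  have /closed_nonrootP[y nrooty] : map_poly phi b != 0.
    by apply/eqP => /polyP/(_ i); rewrite coef_map coef0; apply/eqP.
  exists y; split=> [f Pf|]; last exact: nrooty.
  by apply: kill => //; apply: contrapT => nf; apply: allP; exists f.
have [f [Pf nPl smallf]] := minimal_lead idP (fun _ => id) Pf0 nf0.
have nz h : ~ P (lead_coef h)%:P -> h != 0.
  by move=> nP; apply/eqP => h0; apply: nP; rewrite h0 lead_coef0.
have f_neq0 := nz _ nPl.
pose Q := ideal_adjoin [set: _] P b.
have idQ : is_ideal [set: _] Q.
  by apply: (ideal_adjoin_is_ideal (is_subringT _)).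
have PQ : P `<=` Q by apply: (sub_ideal_adjoin (is_subringT _)).
have Qb : Q b by apply: (mem_ideal_adjoin (is_subringT _)).
have [h [Qh nPlh smallh]] := minimal_lead idQ PQ (PQ _ Pf0) nf0.
have h_neq0 := nz _ nPlh.
have lehf : (size h <= size f)%N.
  by rewrite leqNgt; apply/negP => /(smallh _ (PQ _ Pf)) /(_ (size f).-1).
(* Otherwise divide f and b by h, whose remainders are zero modulo p. From f,
   either h is in P, which puts b in P, or the quotient is in P and of smaller
   degree than f, so that f itself is zero modulo p. *)
have szh : (size h <= 1)%N.
  rewrite leqNgt; apply/negP => szh.
  have Prf := pdiv_small idQ PQ smallh h_neq0 Qh (PQ _ Pf).
  have Prb := pdiv_small idQ PQ smallh h_neq0 Qh Qb.
  have [Pq|Ph] : P (f %/ h) \/ P h.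
  - apply: PM; rewrite (_ : _ * h = lead_coef h ^+ scalp f h *: f - f %% h).
      apply: (idealB (is_subringT _)) => //; last exact: coefs_in_P.
      by rewrite -mul_polyC; apply: PMl.
    by rewrite divp_eq addrK.
  - have szq : (size (f %/ h)%R < size f)%N.
      rewrite size_divp // ltn_subrL size_poly_gt0 f_neq0 andbT.
      by rewrite -subn1 subn_gt0.
    have := coefs_inD (coefs_inM h (smallf _ Pq szq)) Prf.
    rewrite mulrC -divp_eq => /(_ (size f).-1).
    by rewrite coefZ rmorphM => /PM[]; [apply: lead_pow|].
  have : P ((lead_coef h ^+ scalp b h)%:P * b).
    by rewrite mul_polyC divp_eq; apply: PD; [apply: PMl | apply: coefs_in_P].
  by case/PM => //; apply: lead_pow.
have hE : h = (lead_coef h)%:P.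
  by rewrite [LHS]size1_polyC // lead_coefE; case: (size h) szh => [|[]].
exists (lead_coef f * lead_coef h) => [|k phi phiP].
  by rewrite rmorphM => /PM[].
rewrite rmorphM mulf_eq0 negb_or => /andP[phif phih].
have szf : size (map_poly phi f) = size f by rewrite size_map_poly_id0.
have /closed_rootP[y rooty] : size (map_poly phi f) != 1.
  rewrite szf; apply/eqP => sf1; apply: nPl.
  by rewrite lead_coefE sf1 -size1_polyC ?sf1.
have phif0 : eval_at phi y f = 0 by apply/eqP.
have evP g : P g -> eval_at phi y g = 0.
  move=> Pg; have Pr := pdiv_small idP (fun _ => id) smallf f_neq0 Pf Pg.
  have /(congr1 (eval_at phi y)) := divp_eq g f.
  rewrite -mul_polyC rmorphD [in RHS]rmorphM phif0 mulr0 add0r.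
  rewrite (kill _ _ _ _ phiP Pr).
  rewrite rmorphM eval_atE map_polyC hornerC => /eqP.
  have phin n : phi (lead_coef f ^+ n) != 0 by rewrite rmorphXn expf_neq0.
  by rewrite mulf_eq0 (negbTE (phin _)) => /eqP.
exists y; split=> //; apply/eqP => phib0.
case: Qh => u [v [Pu _ /(congr1 (eval_at phi y))]].
rewrite rmorphD [in RHS]rmorphM phib0 mulr0 addr0 (evP _ Pu) hE eval_atE.
by rewrite map_polyC hornerC; apply/eqP.
Qed.

End Extension.

Section Nullstellensatz.
Variable k : closedFieldType.

Lemma scalar_points_field : scalar_points (idfun : {rmorphism k -> k}).
Proof.
move=> P b primeP nPb; exists idfun; split=> // [x Px|].
  have [//|x0] := eqVneq x 0; have [[_ _ _ PM] _ _] := primeP.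
  by case: (prime_ideal1 primeP); rewrite -(mulVf x0); apply: PM.
by apply/eqP => /= b0; apply: nPb; rewrite b0; case: primeP => -[].
Qed.

Lemma scalar_points_poly (A : idomainType) (c : {rmorphism k -> A}) :
  scalar_points c -> scalar_points (polyC \o c).
Proof.
move=> ptA P b primeP nPb; have [a nPa ext] := point_extension primeP nPb.
have [phi [phic phiP phia]] := ptA _ _ (prime_preim (polyC) primeP) nPa.
have [y [yP yb]] := ext _ _ phiP phia.
exists (eval_at phi y); split=> // x.
by rewrite eval_atE /= map_polyC hornerC; apply: phic.
Qed.

Lemma scalar_points_mpoly n : scalar_points (@mpolyC n k).
Proof.
elim: n => [|n IHn] P b primeP nPb.
  have primeP' := prime_preim (@mpolyC 0 k) primeP.
  have sur (p : {mpoly k[0]}) : p = (p@_0)%:MP.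
    apply/mpolyP => m; rewrite mcoeffC.
    by rewrite (_ : m = 0%MM) ?eqxx ?mulr1 //; apply/mnmP => -[].
  have [|phi [phic phiP phib]] := scalar_points_field (b := b@_0) primeP'.
    by rewrite /= -sur.
  exists (phi \o @mcoeff 0 k 0); split=> [x|x Px|].
    by rewrite /= mpolyCK; apply: phic.
    by apply: phiP; rewrite /preimage /= -sur.
  exact: phib.
have primeP' := prime_preim (@poly_mpoly k n) primeP.
have muniP p : (@poly_mpoly k n @^-1` P) (muni p) = P p.
  exact: (f_equal (fun x => P x) (muniK p)).
have [|phi [phic phiP phib]] := scalar_points_poly IHn primeP' (b := muni b).
  by rewrite muniP.
exists (phi \o @muni n k); split=> [x|x Px|//]; last first.
  by apply: phiP; rewrite muniP.
by rewrite /= muniC; apply: phic.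
Qed.

End Nullstellensatz.

(** * Subspaces of finite codimension *)

Section Subspaces.
Variables (k : fieldType) (S : lmodType k).
Implicit Types (U V W : set S) (s t : seq S).

Definition subspace V : Prop :=
  [/\ V 0, forall x y, V x -> V y -> V (x + y) & forall c x, V x -> V (c *: x)].

Lemma subspaceB V x y : subspace V -> V x -> V y -> V (x - y).
Proof. by case=> _ VD VZ Vx Vy; rewrite -scaleN1r; apply/VD/VZ. Qed.

(** The space spanned by s modulo U. *)
Fixpoint kspan U s : set S :=
  if s is y :: s' then [set x | exists c, kspan U s' (x - c *: y)] else U.

Lemma kspan_subspace U s : subspace U -> subspace (kspan U s).
Proof.
move=> subU; elim: s => //= y s [s0 sD sZ]; split.
- by exists 0; rewrite scale0r subr0.
- move=> x z [c xc] [d zd]; exists (c + d).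
  by rewrite scalerDl opprD addrACA; apply: sD.
- move=> a x [c xc]; exists (a * c).
  by rewrite -scalerA -scalerBr; apply: sZ.
Qed.

Lemma sub_kspan U s : U `<=` kspan U s.
Proof.
elim: s => //= y s IHs x /IHs sx; exists 0; by rewrite scale0r subr0.
Qed.

Lemma mem_kspan U s x : subspace U -> x \in s -> kspan U s x.
Proof.
move=> subU; elim: s => //= y s IHs /[!inE] /predU1P[->|/IHs sx].
  by exists 1; rewrite scale1r subrr; case: (kspan_subspace s subU).
by exists 0; rewrite scale0r subr0.
Qed.

Lemma kspan_min U s V : subspace V -> U `<=` V -> (forall x, x \in s -> V x) ->
  kspan U s `<=` V.
Proof.
move=> [V0 VD VZ] UV; elim: s => [|y s IHs] sV //= x [c sx].
rewrite -[x](subrK (c *: y)); apply: VD; last by apply/VZ/sV/mem_head.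
by apply: IHs sx => z zs; apply: sV; rewrite inE zs orbT.
Qed.

(** A subspace of a finite dimensional space is finite dimensional, relative
    to U. *)
Lemma subspace_fg U W s :
  subspace U -> subspace W -> U `<=` W -> W `<=` kspan U s ->
  exists2 t, (forall x, x \in t -> W x) & W `<=` kspan U t.
Proof.
move=> subU; elim: s W => [|y s IHs] W subW UW Ws; first by exists [::].
have [s0 sD sZ] := kspan_subspace s subU; have [W0 WD WZ] := subW.
have [|||t tW Wt] := IHs (W `&` kspan U s).
- split=> // [x z [Wx sx] [Wz sz]|c x [Wx sx]]; split; auto.
- by move=> x Ux; split; [exact: UW | exact: sub_kspan].
- exact: subIsetr.
have [WsW|/existsNP[w /not_implyP[Ww nsw]]] := pselect (W `<=` kspan U s).
  exists t => [x /tW[]//|x Wx]; apply: Wt; split=> //; exact: WsW.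
(* W is spanned by its intersection with the previous span and by the single
   vector w, whose last coordinate c is nonzero. *)
have [c sc] := Ws _ Ww.
have c0 : c != 0.
  by apply/eqP => c0; apply: nsw; move: sc; rewrite c0 scale0r subr0.
exists (w :: t) => [x /[!inE] /predU1P[->//|/tW[]//]|x Wx].
have [d sd] := Ws _ Wx; exists (d / c); apply: Wt; split.
  by apply: subspaceB => //; apply: WZ.
have -> : x - (d / c) *: w = (x - d *: y) - (d / c) *: (w - c *: y).
  by rewrite scalerBr scalerA divfK // opprB addrA subrK.
by apply: subspaceB; [apply: kspan_subspace | | apply: sZ].
Qed.

(** Finite codimension as a subspace, not finite complement. *)
Definition cofinite U : Prop := exists s, forall x, kspan U s x.

Lemma cofinite_sub U V : subspace V -> U `<=` V -> cofinite U -> cofinite V.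
Proof.
move=> subV UV [s Us]; exists s => x.
apply: (kspan_min (kspan_subspace s subV)) (Us x).
  exact: subset_trans UV (@sub_kspan _ _).
by move=> y; apply: mem_kspan.
Qed.

End Subspaces.

(** * Primes of a finitely generated algebra *)

Section Algebra.
Variables (k : closedFieldType) (S : idomainAlgType k).
Implicit Types (I J P M : set S) (x y : S).

Lemma ideal_subspace J : is_ideal [set: S] J -> subspace J.
Proof.
by case=> _ J0 JD JM; split=> // c x Jx; rewrite -mulr_algl; apply: JM.
Qed.

Lemma subspace_mulr V y : subspace V -> subspace [set x : S | V (x * y)].
Proof.
case=> V0 VD VZ; split=> [|x z Vx Vz|c x Vx] /=.
- by rewrite mul0r.
- by rewrite mulrDl; apply: VD.
- by rewrite -scalerAl; apply: VZ.
Qed.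

Lemma ideal_scalar J (c : k) : is_ideal [set: S] J -> ~ J 1 -> J c%:A -> c = 0.
Proof.
move=> [_ _ _ JM] nJ1 Jc; apply/eqP; apply: contrapT => /negP c0; apply: nJ1.
by rewrite -[1]scale1r -(mulVf c0) -scalerA -mulr_algl; apply: JM.
Qed.

(** For a proper ideal M, this says that the residue ring is k. *)
Definition scalar_residues M : Prop := forall x, exists c : k, M (x - c%:A).

Lemma scalar_residues_max M :
  is_ideal [set: S] M -> ~ M 1 -> scalar_residues M -> Max [set: S] M.
Proof.
move=> idM nM1 resM; split=> //; first by move=> E; apply: nM1; rewrite E.
move=> J idJ MJ; have [J1|nJ1] := pselect (J 1); [right | left].
  apply/seteqP; split=> // x _; rewrite -[x]mulr1.
  by case: idJ => _ _ _; apply.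
apply/seteqP; split=> // x Jx; have [c Mc] := resM x.
suff c0 : c = 0 by rewrite c0 scale0r subr0 in Mc.
apply: (ideal_scalar idJ nJ1).
rewrite (_ : c%:A = x - (x - c%:A)); last by rewrite opprB addrC subrK.
by apply: (idealB (is_subringT _)) => //; apply: MJ.
Qed.

Lemma scalar_residues_cofinite M : scalar_residues M -> cofinite M.
Proof. by move=> resM; exists [:: 1]. Qed.

(** Powers of x span a finite dimensional space modulo P, so x is a root modulo
    P of a nonzero polynomial over k. This polynomial splits, and one of its
    linear factors takes a value in the prime P at x. *)
Lemma cofinite_prime_residues P :
  Spec [set: S] P -> cofinite P -> scalar_residues P.
Proof.
move=> primeP [s Ps] x; have [idP _ PM] := primeP.
have subP := ideal_subspace idP; have [P0 PD PZ] := subP.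
pose h : {rmorphism {poly k} -> S} := horner_alg x.
have hC c : h c%:P = c%:A by exact: horner_algC.
have hX : h 'X = x by exact: horner_algX.
have hXn n : h 'X^n = x ^+ n by rewrite rmorphXn hX.
(* Polynomials in x of degree less than N, modulo P. *)
pose W N := [set y | exists2 p : {poly k},
  (size p <= N)%N & P (y - h p)].
have subW N : subspace (W N).
  split.
  - by exists 0; rewrite ?size_poly0 // rmorph0 subr0.
  - move=> y z [p sp Pp] [q sq Pq]; exists (p + q).
      by rewrite (leq_trans (size_polyD _ _)) // geq_max sp.
    by rewrite rmorphD opprD addrACA; apply: PD.
  - move=> c y [p sp Pp]; exists (c *: p).
      by rewrite (leq_trans (size_scale_leq _ _)).
    by rewrite -mul_polyC rmorphM hC mulr_algl -scalerBr; apply: PZ.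
have PW N : P `<=` W N.
  by move=> y Py; exists 0; rewrite ?size_poly0 // rmorph0 subr0.
have mono m n : (m <= n)%N -> W m `<=` W n.
  by move=> lemn y [p sp Pp]; exists p => //; apply: leq_trans lemn.
pose WW := \bigcup_N W N.
have [|||t tW Wt] := @subspace_fg _ _ P WW s subP; last 1 first.
- have [N tN] : exists N, forall y, y \in t -> W N y.
    elim: t tW {Wt} => [|y t IHt] tW; first by exists 0%N.
    have [|N tN] := IHt; first by move=> z zt; apply: tW; rewrite inE zt orbT.
    have [m _ Wy] := tW y (mem_head _ _).
    exists (maxn m N) => z /[!inE] /predU1P[->|/tN].
      by apply: mono Wy; rewrite leq_maxl.
    by apply: mono; rewrite leq_maxr.
  have [p sp Pp] : W N (x ^+ N).
    apply: (kspan_min (subW N) (@PW N) tN); apply: Wt; exists N.+1 => //.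
    by exists 'X^N; rewrite ?size_polyXn // hXn subrr.
  pose q := 'X^N - p.
  have Pq : P (h q) by rewrite rmorphB hXn.
  have q0 : q != 0.
    apply/eqP => /polyP /(_ N); rewrite coefB coefXn eqxx coef0 nth_default //.
    by rewrite subr0 => /eqP; rewrite oner_eq0.
  have [r qE] := closed_field_poly_normal q.
  have : P (\prod_(z <- r) (x - z%:A)).
    move: (Pq); rewrite qE -mul_polyC rmorphM hC rmorph_prod mulr_algl.
    have -> : \prod_(z <- r) h ('X - z%:P) = \prod_(z <- r) (x - z%:A).
      by apply: eq_bigr => z _; rewrite rmorphB hX hC.
    move/(PZ (lead_coef q)^-1); rewrite scalerA mulVf ?lead_coef_eq0 //.
    by rewrite scale1r.
  elim: r {qE} => [|z r IHr].
    by rewrite big_nil => /(prime_ideal1 primeP).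
  by rewrite big_cons => /PM[]// Pz; exists z.
- split=> [|y z [m _ Wy] [n _ Wz]|c y [m _ Wy]].
  + by exists 0%N => //; case: (subW 0%N).
  + exists (maxn m n) => //; have [_ WD _] := subW (maxn m n).
    by apply: WD; [move: Wy | move: Wz]; apply: mono;
      rewrite ?leq_maxl ?leq_maxr.
  + by exists m => //; have [_ _ WZ] := subW m; apply: WZ.
- by move=> y Py; exists 0%N => //; apply: PW.
- by move=> y _; apply: Ps.
Qed.

(** Take P maximal among the ideals over I of infinite codimension. If P
    contained ab but neither a nor b, then P + Sa and P + Sb would have finite
    codimension, and so would P, since multiplication by a maps the quotient by
    P + Sb onto the quotient of P + Sa by P. *)
Lemma noncofinite_prime I :
  noetherian [set: S] -> is_ideal [set: S] I -> ~ cofinite I ->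
  exists P, [/\ Spec [set: S] P, I `<=` P & ~ cofinite P].
Proof.
move=> nS idI nI; have subT := is_subringT S.
pose F J := is_ideal [set: S] J /\ ~ cofinite J.
have [|//|P [[idP nP] IP maxP]] := @noetherian_max _ _ subT F I nS.
  by move=> J [].
exists P; split=> //; split=> //.
  by move=> PT; apply: nP; exists [::] => x; rewrite PT.
have [_ _ PD PM] := idP.
have cof c : ~ P c -> cofinite (ideal_adjoin [set: S] P c).
  move=> nPc; apply: contrapT => nQ; apply: nPc.
  apply: (maxP (ideal_adjoin setT P c)); last exact: mem_ideal_adjoin.
    by split=> //; apply: ideal_adjoin_is_ideal.
  exact: sub_ideal_adjoin.
move=> a b _ _ Pab; apply: contrapT => /not_orP[/cof[s Qs] /cof[t Qt]].
apply: nP; exists (s ++ [seq y * a | y <- t]) => x.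
have subV := kspan_subspace (s ++ [seq y * a | y <- t]) (ideal_subspace idP).
have [_ VD _] := subV.
apply: kspan_min (Qs x) => // [_ [p [r [Pp _ ->]]]|y ys]; last first.
  by apply: mem_kspan; [exact: ideal_subspace | rewrite mem_cat ys].
apply: VD; first exact: sub_kspan.
apply: (kspan_min (subspace_mulr a subV)) (Qt r).
  move=> _ [p' [r' [Pp' _ ->]]].
  apply: sub_kspan; rewrite mulrDl -mulrA [b * a]mulrC [p' * a]mulrC.
  by apply: PD; apply: PM.
move=> y yt; apply: mem_kspan; first exact: ideal_subspace.
by rewrite mem_cat (map_f (fun y => y * a)) ?orbT.
Qed.

Section FinitelyGenerated.
Hypothesis Sfg : finitely_generated_alg S.

Lemma noetherian_fg : noetherian [set: S].
Proof.
have [n [g gen]] := Sfg.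
apply: (@noetherian_surj _ _ (mmap (in_alg S) g)).
  by move=> y; have [p ->] := gen y; exists p.
by apply/noetherian_mpoly/noetherian_field.
Qed.

(** A point of the polynomial ring that kills the preimage of P is a morphism to
    k, and the image of its kernel in S is the required maximal ideal. *)
Lemma nullstellensatz P b : Spec [set: S] P -> ~ P b ->
  exists M, [/\ Max [set: S] M, P `<=` M, ~ M b & scalar_residues M].
Proof.
have [n [g gen]] := Sfg => primeP nPb.
pose h : {rmorphism {mpoly k[n]} -> S} := mmap (in_alg S) g.
have hC c : h c%:MP = c%:A by exact: mmapC.
have h_surj y : exists p, h p = y by have [p ->] := gen y; exists p.
have primeP' := prime_preim h primeP.
have [q qb] := h_surj b.
have [|phi [phic phiP phiq]] := scalar_points_mpoly primeP' (b := q).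
  by rewrite /preimage /mkset qb.
have [[_ P0 _ _] _ _] := primeP.
pose M := [set y | exists2 p, h p = y & phi p = 0].
have nMb : ~ M b.
  case=> p pb phip; move/eqP: phiq; apply.
  rewrite -[q](subrK p) rmorphD phip addr0; apply: phiP.
  by rewrite /preimage /mkset rmorphB pb qb subrr.
have idM : is_ideal [set: S] M.
  split=> //; first by exists 0; rewrite rmorph0.
    move=> _ _ [p <- phip] [r <- phir].
    exists (p + r); first by rewrite rmorphD.
    by rewrite rmorphD phip phir addr0.
  move=> y _ _ [p <- phip]; have [r <-] := h_surj y.
  by exists (r * p); rewrite rmorphM // phip mulr0.
have resM : scalar_residues M.
  move=> y; have [p <-] := h_surj y; exists (phi p), (p - (phi p)%:MP).
    by rewrite rmorphB hC.
  by rewrite rmorphB phic subrr.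
exists M; split=> //.
  apply: scalar_residues_max => // M1; apply: nMb.
  by rewrite -[b]mulr1; case: idM => _ _ _; apply.
move=> y Py; have [p yp] := h_surj y; exists p => //.
by apply: phiP; rewrite /preimage /mkset yp.
Qed.

End FinitelyGenerated.
End Algebra.

(** * The ring of scalars plus an ideal *)

Section ScalarsPlus.
Variables (k : closedFieldType) (S : idomainAlgType k) (I : set S).
Hypotheses (idI : is_ideal [set: S] I) (nI1 : ~ I 1).
Local Notation R := (scalars_plus I).

Let I0 : I 0. Proof. by case: idI. Qed.
Let ID x y : I x -> I y -> I (x + y).
Proof. by case: idI => _ _ + _; apply. Qed.
Let IM x y : I y -> I (x * y). Proof. by case: idI => _ _ _; apply. Qed.
Let IMr x y : I x -> I (x * y). Proof. by rewrite mulrC; apply: IM. Qed.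
Let IB x y : I x -> I y -> I (x - y).
Proof. exact: (idealB (is_subringT _)). Qed.

Lemma sub_scalars_plus : I `<=` R.
Proof. by move=> x Ix; exists 0, x; rewrite scale0r add0r. Qed.

Lemma scalars_plus_scalar (c : k) : R c%:A.
Proof. by exists c, 0; rewrite addr0. Qed.

Lemma scalars_plus_subring : is_subring R.
Proof.
split; first by exists 1, 0; rewrite scale1r addr0.
- move=> _ _ [c [x [Ix ->]]] [d [y [Iy ->]]]; exists (c - d), (x - y).
  by rewrite scalerBl opprD addrACA; split=> //; apply: IB.
- move=> _ _ [c [x [Ix ->]]] [d [y [Iy ->]]].
  exists (c * d), (c%:A * y + x * (d%:A + y)); split.
    by apply: ID; [apply: IM | apply: IMr].
  by rewrite mulrDl mulrDr -addrA [c%:A * d%:A]mulr_algl scalerA.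
Qed.

Lemma scalars_plus_unit x : R x -> ~ I x ->
  exists c i, [/\ c != 0, I i & x = c%:A + i].
Proof.
case=> c [i [Ii xE]] nIx; exists c, i; split=> //.
by apply/eqP => c0; apply: nIx; rewrite xE c0 scale0r add0r.
Qed.

(** The quotient is the field k. This prime is where R and S differ. *)
Lemma conductor_prime : Spec R I.
Proof.
have [R1 _ RM] := scalars_plus_subring; split.
- by split=> // [|a x _]; [exact: sub_scalars_plus | exact: IM].
- by move=> E; apply: nI1; rewrite E.
- move=> a b Ra Rb Iab; have [Ia|nIa] := pselect (I a); [by left | right].
  have [c [i [c0 Ii aE]]] := scalars_plus_unit Ra nIa.
  have : I (c^-1%:A * (a * b - i * b)) by apply/IM/IB => //; apply: IMr.
  rewrite -mulrBl aE addrK mulrA -scalerAl mul1r scalerA mulVf //.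
  by rewrite scale1r mul1r.
Qed.

Lemma scalars_plus_max P :
  is_ideal R P -> ~ P 1 -> I `<=` P -> P = I.
Proof.
move=> idP nP1 IP; have [PR P0 PD PM] := idP.
apply/seteqP; split=> // x Px; apply: contrapT => nIx.
have [c [i [c0 Ii xE]]] := scalars_plus_unit (PR _ Px) nIx.
apply: nP1; have -> : 1 = c^-1%:A * (x - i).
  by rewrite xE addrK -scalerAl mul1r scalerA mulVf // scale1r.
apply: PM; first exact: scalars_plus_scalar.
by apply: (idealB scalars_plus_subring) => //; apply: IP.
Qed.

Lemma contract_above P : Spec [set: S] P -> I `<=` P -> P `&` R = I.
Proof.
move=> primeP IP; apply: scalars_plus_max.
- by have [] := spec_contract scalars_plus_subring primeP.
- by move=> [/(prime_ideal1 primeP)].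
- by move=> x Ix; split; [apply: IP | apply: sub_scalars_plus].
Qed.

(** The fractions (as)/b with b outside I form an ideal of the localization of
    R at I. Let the numerators of its generators come from a list ss, and let V
    be the span of ss modulo I. The same fractions with s in V also form an
    ideal, because R acts on V through scalars modulo I; hence it is the whole
    ideal. Then for every s some b outside I satisfies bs in V, and b is a
    nonzero scalar modulo I. *)
Lemma cofinite_of_local a : I a -> a != 0 ->
  noetherian (localization R I) -> cofinite I.
Proof.
move=> Ia a0; have subR := scalars_plus_subring; have primeI := conductor_prime.
have subI := ideal_subspace idI; have [R1 RB RM] := subR.
have [_ _ IP] := primeI.
have subL := is_subring_localization subR primeI.
have ta0 : tofrac a != 0 by rewrite tofrac_eq0.
have n0 b : ~ I b -> tofrac b != 0.
  by move=> nIb; rewrite tofrac_eq0; apply/eqP => b0; apply: nIb; rewrite b0.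
pose K (V : set S) := [set z | exists s b,
  [/\ V s, R b, ~ I b & z = tofrac (a * s) / tofrac b]].
have VR (V : set S) x s : subspace V -> I `<=` V -> R x -> V s -> V (x * s).
  move=> [_ VD VZ] IV [c [i [Ii ->]]] Vs.
  by rewrite mulrDl mulr_algl; apply: VD; [apply: VZ | apply/IV/IMr].
have idK V : subspace V -> I `<=` V -> is_ideal (localization R I) (K V).
  move=> subV IV; have [V0 VD VZ] := subV; split.
  - move=> _ [s [b [Vs Rb nIb ->]]]; exists (a * s), b; split=> //.
    by apply/sub_scalars_plus/IMr.
  - by exists 0, 1; split=> //; rewrite mulr0 tofrac0 mul0r.
  - move=> _ _ [s [b [Vs Rb nIb ->]]] [t [d [Vt Rd nId ->]]].
    exists (d * s + b * t), (b * d); split.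
    + by apply: VD; apply: VR.
    + exact: RM.
    + by move/(IP _ _ Rb Rd) => [].
    rewrite addf_div ?n0 // -!tofracM -tofracD; congr (tofrac _ / _).
    by ring.
  - move=> _ _ [x [d [Rx Rd nId ->]]] [s [b [Vs Rb nIb ->]]].
    exists (x * s), (d * b); split.
    + exact: VR.
    + exact: RM.
    + by move/(IP _ _ Rd Rb) => [].
    rewrite mulf_div -!tofracM; congr (tofrac _ / _).
    by ring.
have subT : subspace [set: S] by [].
move=> /(noetherianP subL) /(_ _ (idK _ subT (fun _ _ => Logic.I))).
case=> l lK Kl.
have [ss lss] : exists ss : seq S, forall V, (forall s, s \in ss -> V s) ->
    forall z, z \in l -> K V z.
  elim: l lK {Kl} => [|z l IHl] lK; first by exists [::].
  have [|ss lss] := IHl; first by move=> y yl; apply: lK; rewrite inE yl orbT.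
  have [s [b [_ Rb nIb zE]]] := lK z (mem_head _ _).
  exists (s :: ss) => V ssV y /[!inE] /predU1P[->|yl].
    by exists s, b; split=> //; apply/ssV/mem_head.
  by apply: lss yl => t tss; apply: ssV; rewrite inE tss orbT.
exists ss => s.
have subV := kspan_subspace ss subI; have IV := @sub_kspan _ _ I ss.
have Kas : K setT (tofrac (a * s)).
  by exists s, 1; split=> //; rewrite tofrac1 divr1.
have Vss y : y \in ss -> kspan I ss y := mem_kspan subI.
have [t [b [Vt Rb nIb /eqP]]] := Kl _ (idK _ subV IV) (lss _ Vss) _ Kas.
rewrite eq_sym -(mulfK (n0 _ nIb) (tofrac (a * s))).
rewrite (inj_eq (mulIf _)) ?invr_eq0 ?n0 //.
rewrite -tofracM tofrac_eq -mulrA (inj_eq (mulfI a0)) => /eqP tE.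
have [c [i [c0 Ii bE]]] := scalars_plus_unit Rb nIb.
have -> : s = c^-1 *: (t - s * i).
  by rewrite tE bE mulrDr addrK mulr_algr scalerA mulVf // scale1r.
have [_ _ VZ] := subV; apply: VZ.
by apply: subspaceB => //; apply/IV/IM.
Qed.

(** Given an ideal J of R, let U be the largest ideal of S inside J; it
    contains IJ. As JS is generated over S by finitely many elements of J, and
    S is I plus a finite dimensional space, JS is finite dimensional modulo U,
    and so is J. Generators of U over S, multiplied by 1 and by the list es
    that spans S modulo I, generate U over R. *)
Lemma noetherian_of_cofinite :
  noetherian [set: S] -> cofinite I -> noetherian R.
Proof.
move=> nS [es Ies].
have subR := scalars_plus_subring; have [R1 RB RM] := subR.
have subI := ideal_subspace idI.
have ideal_R_subspace J : is_ideal R J -> subspace J.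
  case=> _ J0 JD JM; split=> // c x Jx; rewrite -mulr_algl.
  by apply: JM => //; apply: scalars_plus_scalar.
have spread V y : subspace V -> (forall i, I i -> V (i * y)) ->
    (forall e, e \in es -> V (e * y)) -> forall s, V (s * y).
  move=> subV IV eV s.
  exact: (kspan_min (subspace_mulr y subV) IV eV) (Ies s).
apply/(noetherianP subR) => J idJ; have [JR J0 JD JM] := idJ.
have subJ := ideal_R_subspace _ idJ.
pose U := [set x | forall s, J (s * x)].
have UJ : U `<=` J by move=> x /(_ 1); rewrite mul1r.
have idU : is_ideal [set: S] U.
  split=> // [s|x y Ux Uy s|a x _ Ux s].
  - by rewrite mulr0.
  - by rewrite mulrDr; apply: JD.
  - by rewrite mulrA; apply: Ux.
have IJU i j : I i -> J j -> U (i * j).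
  by move=> Ii Jj s; rewrite mulrA; apply: JM => //; apply/sub_scalars_plus/IM.
have [js jsJ Jjs] :=
  noetherian_span (is_subringT _) nS (fun x (_ : J x) => Logic.I).
have [us usU Uus] := (noetherianP (is_subringT _)).1 nS _ idU.
pose ejs := [seq e * j | e <- es, j <- js].
have subU := ideal_subspace idU.
pose V := kspan U ejs.
have subV : subspace V := kspan_subspace ejs subU.
have UV : U `<=` V := @sub_kspan _ _ U ejs.
have jV j s : j \in js -> V (s * j).
  move=> jjs; apply: spread => // [i Ii|e ees].
    by apply/UV/IJU => //; apply: jsJ.
  by apply: mem_kspan => //; apply: allpairs_f.
have JV : J `<=` V.
  have idW : is_ideal [set: S] [set x | forall s, V (s * x)].
    have [V0 VD _] := subV; split=> // [s|x y Vx Vy s|a x _ Vx s].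
    - by rewrite mulr0.
    - by rewrite mulrDr; apply: VD.
    - by rewrite mulrA; apply: Vx.
  move=> x Jx; rewrite -[x]mul1r.
  by apply: (Jjs _ idW) => // j jjs s; apply: jV.
have [t tJ Jt] := subspace_fg subU subJ UJ JV.
pose gens := us ++ [seq e * u | e <- es, u <- us] ++ t.
exists gens => [x|K idK gK].
  rewrite !mem_cat => /or3P[/usU/UJ//|/allpairsP[[e u] [_ /usU Uu ->]]|/tJ//].
  exact: Uu.
have subK := ideal_R_subspace _ idK.
have UK : U `<=` K.
  have idW : is_ideal [set: S] [set x | forall s, K (s * x)].
    have [K0 KD _] := subK; split=> // [s|x y Kx Ky s|a x _ Kx s].
    - by rewrite mulr0.
    - by rewrite mulrDr; apply: KD.
    - by rewrite mulrA; apply: Kx.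
  move=> x Ux; rewrite -[x]mul1r.
  apply: (Uus _ idW) => // u uus; apply: spread => // [i Ii|e ees].
    have [_ _ _ KM] := idK; apply: KM; first exact: sub_scalars_plus.
    by apply: gK; rewrite mem_cat uus.
  by apply: gK; rewrite !mem_cat allpairs_f ?orbT.
apply: subset_trans Jt _; apply: kspan_min => // x xt.
by apply: gK; rewrite !mem_cat xt !orbT.
Qed.

(** A prime P of R that does not contain I is the contraction of its colon
    (P : I) in S, and the only prime that contains I is I itself, which is
    contracted from any prime of S over I. *)
Lemma spec_surj : (exists P, Spec [set: S] P /\ I `<=` P) ->
  set_surj (Spec [set: S]) (Spec R) (fun q => q `&` R).
Proof.
move=> [P0 [primeP0 IP0]] P primeP; have subR := scalars_plus_subring.
have [idP PnR PM] := primeP; have [PR Pz PD PMl] := idP.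
have [IP|/existsNP[a /not_implyP[Ia nPa]]] := pselect (I `<=` P).
  exists P0 => //; rewrite contract_above //.
  by rewrite -(scalars_plus_max idP) //; apply: prime_ideal1 primeP.
have RI i : I i -> R i := @sub_scalars_plus i.
pose Q := [set s | forall i, I i -> P (s * i)].
have QR : Q `&` R = P.
  apply/seteqP; split=> [s [Qs Rs]|s Ps].
    by have [//|/nPa] := PM _ _ Rs (RI _ Ia) (Qs _ Ia).
  split=> [i Ii|]; last exact: PR.
  by rewrite mulrC; apply: PMl => //; apply: RI.
have Qa s : P (s * a) -> Q s.
  move=> Psa i Ii; have Psia : P (s * i * a).
    by rewrite mulrAC mulrC; apply: PMl => //; apply: RI.
  by have [//|/nPa] := PM _ _ (RI _ (IM s Ii)) (RI _ Ia) Psia.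
exists Q => //; split.
- split=> // [i Ii|x y Qx Qy i Ii|b x _ Qx i Ii].
  + by rewrite mul0r.
  + by rewrite mulrDl; apply: PD; [apply: Qx | apply: Qy].
  + by rewrite -mulrA mulrCA; apply/Qx/IM.
- move=> QT; apply: (prime_ideal1 primeP); rewrite -QR QT; split=> //.
  by case: subR.
- move=> x y _ _ Qxy.
  have : P ((x * a) * (y * a)).
    by rewrite mulrACA mulrA -mulrA; apply/Qxy/IM.
  by case/PM => [||/Qa|/Qa]; [apply/RI/IM | apply/RI/IM | left | right].
Qed.

(** Multiply numerator and denominator by an element of I outside n. *)
Lemma localization_away n : Spec [set: S] n -> ~ I `<=` n ->
  localization R (n `&` R) = localization [set: S] n.
Proof.
move=> primen /existsNP[a /not_implyP[Ia nna]]; have [idn _ nM] := primen.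
have a0 : tofrac a != 0.
  by rewrite tofrac_eq0; apply/eqP => a0; apply: nna; rewrite a0; case: idn.
apply/seteqP; split=> _ [x [y [Rx Ry ny ->]]].
  by exists x, y; split=> // nny; apply: ny.
exists (x * a), (y * a); split.
- by apply/sub_scalars_plus/IM.
- by apply/sub_scalars_plus/IM.
- by case=> /nM[].
- by rewrite !tofracM -mulf_div divff // mulr1.
Qed.

End ScalarsPlus.

(** * The quotient by an ideal *)

Section IdealQuotient.
Variables (A : comNzRingType) (I : idealr A).

Lemma idealr_is_ideal : is_ideal [set: A] [set` I].
Proof.
split=> //= [|x y Ix Iy|a x _ Ix].
- exact: rpred0.
- exact: rpredD.
- exact: idealMr.
Qed.

Lemma idealr_proper : ~ [set` I] 1.
Proof. by rewrite /= idealr1. Qed.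

Definition quot_proj : {rmorphism A -> {ideal_quot I}} :=
  \pi_({ideal_quot I})%qT.

Lemma quot_proj_surj y : exists x, quot_proj x = y.
Proof. by exists (repr y); rewrite /= reprK. Qed.

Lemma quot_proj_eq0 x : quot_proj x = 0 <-> x \in I.
Proof.
rewrite -(rmorph0 quot_proj) -[x in _ <-> x \in _]subr0.
by rewrite Quotient.idealrBE; split=> /eqP.
Qed.

Lemma krull_dim_quot_ge1 : krull_dim_ge [set: {ideal_quot I}] 1 <->
  exists P Q, [/\ Spec [set: A] P, Spec [set: A] Q, [set` I] `<=` P & P `<` Q].
Proof.
split=> [[m m1 [C [primeC ltC]]]|[P [Q [primeP primeQ IP [PQ nQP]]]]].
  exists (quot_proj @^-1` C 0%N), (quot_proj @^-1` C 1%N); split.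
  - exact: (prime_preim _ (primeC 0%N _)).
  - exact: (prime_preim _ (primeC 1%N _)).
  - move=> x /quot_proj_eq0 x0; rewrite /preimage /= [X in C _ X]x0.
    by have [[]] := primeC 0%N isT.
  - have [C01 nC10] := ltC 0%N m1; split=> [x /C01//|sub]; apply: nC10 => y.
    by have [x <-] := quot_proj_surj y; apply: sub.
have kerP x : quot_proj x = 0 -> P x by move/quot_proj_eq0/IP.
have kerQ x : quot_proj x = 0 -> Q x by move/kerP/PQ.
exists 1%N => //; exists (fun i => quot_proj @` (if i is 0%N then P else Q)).
split=> [[|i] _|[|//] _].
- exact: prime_image quot_proj_surj kerP primeP.
- exact: prime_image quot_proj_surj kerQ primeQ.
split=> [_ [x Px <-]|sub]; first by exists x => //; apply: PQ.
apply: nQP => x Qx; have [y Py yx] : (quot_proj @` P) (quot_proj x).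
  by apply: sub; exists x.
have [[_ _ PD _] _ _] := primeP.
rewrite -[x](subrK y); apply: PD => //; apply: kerP.
by rewrite rmorphB yx subrr.
Qed.

End IdealQuotient.

(** * The equivalence *)

Theorem corollaryB (k : closedFieldType) (S : idomainAlgType k)
    (Sfg : finitely_generated_alg S)
    (I : idealr S)
    (I_nonmax : ~ Max [set: S] [set` I])
    (I_neq0 : [set` I] <> [set 0])
    (I_rad : radical_ideal [set: S] [set` I]) :
  let R := scalars_plus [set` I] in
  [<-> krull_dim_ge [set: {ideal_quot I}] 1; ~ noetherian R; depicted R].
Proof.
move=> R; have idI := idealr_is_ideal I; have nI1 := @idealr_proper _ I.
set J := [set` I] in idI nI1 I_nonmax I_neq0 I_rad R *.
have subR : is_subring R := scalars_plus_subring idI.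
have primeI : Spec R J := conductor_prime idI nI1.
have nS := noetherian_fg Sfg; have subT := is_subringT S.
have [a [Ja a0]] : exists a, J a /\ a != 0.
  apply: contrapT => noa; apply: I_neq0; apply/seteqP; split=> [x Jx|x ->].
    by apply: contrapT => /eqP x0; apply: noa; exists x.
  by case: idI.
have local_noeth : noetherian (localization R J) <-> cofinite J.
  split; first exact: cofinite_of_local Ja a0.
  by move=> /(noetherian_of_cofinite idI nS); apply: noetherian_localization.
have noeth : noetherian R <-> cofinite J.
  split; last exact: (noetherian_of_cofinite idI nS).
  by move=> nR; apply/local_noeth; apply: noetherian_localization.
have local_S n : Spec [set: S] n -> noetherian (localization [set: S] n).
  by move=> primen; apply: noetherian_localization.
have away n : Spec [set: S] n -> ~ J `<=` n ->
    localization R (n `&` R) = localization [set: S] n.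
  exact: localization_away.
have above n : Spec [set: S] n -> J `<=` n -> n `&` R = J.
  exact: contract_above.
have [P0 [primeP0 JP0 _]] : exists P,
    [/\ Spec [set: S] P, J `<=` P & forall x, [set 1] x -> ~ P x].
  by apply: prime_avoiding => // [x y -> ->|x ->]; rewrite ?mulr1.
tfae.
- move=> /krull_dim_quot_ge1[P [Q [primeP primeQ JP [PQ nQP]]]] /noeth cofJ.
  apply: nQP => x Qx.
  have [idP _ _] := primeP; have [idQ _ _] := primeQ.
  have cofP := cofinite_sub (ideal_subspace idP) JP cofJ.
  have [c Pc] := cofinite_prime_residues primeP cofP x.
  suff c0 : c = 0 by rewrite c0 scale0r subr0 in Pc.
  apply: (ideal_scalar idQ (prime_ideal1 primeQ)).
  rewrite (_ : c%:A = x - (x - c%:A)); last by rewrite opprB addrC subrK.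
  by apply: (idealB subT) => //; apply: PQ.
- move=> nnR; split.
  + apply: spec_surj => //.
    by exists P0.
  + apply/seteqP; split=> n [maxn]; have primen := max_prime subT maxn.
      by move=> locE; split=> //; rewrite locE; apply: local_S.
    have [Jn|nJn] := pselect (J `<=` n); last first.
      by move=> _; split=> //; apply: away.
    by rewrite above // => /local_noeth /noeth.
  + have prime0 : Spec [set: S] [set 0].
      split=> [|E|x y _ _ /eqP].
      * split=> // [x y -> ->|x y _ ->]; by rewrite /= ?addr0 ?mulr0.
      * by move: (oner_neq0 S); have : [set: S] 1 by []; rewrite -E => -> /eqP.
      * by rewrite mulf_eq0 => /orP[]/eqP; [left|right].
    have na0 : ~ [set 0] a by apply/eqP.
    have [n [maxn _ nna _]] := nullstellensatz Sfg prime0 na0.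
    exists n; split=> //; apply: away; first exact: max_prime.
    by move/(_ _ Ja).
- move=> [_ UE _].
  apply/krull_dim_quot_ge1.
  have [cofJ|ncofJ] := pselect (cofinite J); last first.
    have [P [primeP JP ncofP]] := noncofinite_prime nS idI ncofJ.
    have [Q [maxQ PQ _ resQ]] :=
      nullstellensatz Sfg primeP (prime_ideal1 primeP).
    exists P, Q; split=> //; first exact: max_prime.
    split=> // QP; apply: ncofP.
    by rewrite (_ : P = Q); [apply: scalar_residues_cofinite | apply/seteqP].
  have [idI' radJ] := I_rad.
  (* Here R is noetherian, so R and S agree at every maximal ideal. For x in
     n1 outside n2, both maximal over I, the inverse of x is in the
     localization of S at n2; if it were y / b with b in R outside I, then b =
     xy would be in n1, hence in I. *)
  have [n1 [maxn1 Jn1]] : exists n, Max [set: S] n /\ J `<=` n.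
    have [Q [maxQ PQ _ _]] :=
      nullstellensatz Sfg primeP0 (prime_ideal1 primeP0).
    by exists Q; split=> //; apply: subset_trans PQ.
  have primen1 := max_prime subT maxn1.
  have [x [n1x nJx]] : exists x, n1 x /\ ~ J x.
    apply: contrapT => nox; apply: I_nonmax.
    rewrite (_ : J = n1) //; apply/seteqP; split=> // x n1x.
    by apply: contrapT => nJx; apply: nox; exists x.
  have [P [primeP JP xP]] : exists P, [/\ Spec [set: S] P, J `<=` P & ~ P x].
    pose powers := [set y | exists i, y = x ^+ i].
    have powersM y z : powers y -> powers z -> powers (y * z).
      by move=> [i ->] [j ->]; exists (i + j)%N; rewrite exprD.
    have powersJ y : powers y -> ~ J y.
      by move=> [i ->] Jxi; apply: nJx; apply: radJ Jxi.
    have powers1 : powers 1 by exists 0%N; rewrite expr0.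
    have [P [primeP JP xP]] :=
      prime_avoiding subT nS idI powers1 powersM powersJ.
    by exists P; split=> //; apply: xP; exists 1%N; rewrite expr1.
  have [n2 [maxn2 Pn2 nn2x _]] := nullstellensatz Sfg primeP xP.
  have primen2 := max_prime subT maxn2.
  have Jn2 : J `<=` n2 := subset_trans JP Pn2.
  have [_ locE] : U_locus R n2.
    by rewrite UE; split=> //; rewrite above //; apply/local_noeth.
  have x0 : tofrac x != 0.
    by rewrite tofrac_eq0; apply/eqP => x0; apply: nJx; rewrite x0; case: idI.
  have : localization [set: S] n2 (tofrac 1 / tofrac x) by exists 1, x.
  rewrite -locE above // => -[y [b [Ry Rb nJb]]] /eqP.
  have b0 : tofrac b != 0.
    by rewrite tofrac_eq0; apply/eqP => b0; apply: nJb; rewrite b0; case: idI.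
  rewrite eqr_div // -!tofracM tofrac_eq mul1r => /eqP bE.
  have : (n1 `&` R) b.
    by split=> //; rewrite bE; have [[_ _ _ n1M] _ _] := primen1; apply: n1M.
  by rewrite above.
Qed.
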